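(* Let $$f(a,b;z):={}_2F_1\left(a,b;a+b+\tfrac12;z\right),\qquad h(a,b;z):={}_3F_2\left(2a,2b,a+b;2a+2b,a+b+\tfrac12;z\right).$$ Then $h(a,b;z)=f(a,b;z)^2$. Let $u=(1,0,1)$, $v=(0,1,1)$ be the parameter-preserving shifts on the Gauss side (acting on $(a,b,c)$ and preserving $c=a+b+\tfrac12$), and let $U=(2,0,1;2,1)$, $V=(0,2,1;2,1)$ be the induced shifts on the ${}_3F_2$ parameters. If $M_u^{({}_2F_1)},M_v^{({}_2F_1)}$ denote the restricted Gauss-CMF generators and $M_U^{({}_3F_2)},M_V^{({}_3F_2)}$ the corresponding ${}_3F_2$-CMF generators in the basis $(h,\theta h,\theta^2h)$, then $$M_U^{({}_3F_2)}=\Phi^{-1}\,\operatorname{Sym}^2\bigl(M_u^{({}_2F_1)}\bigr)\,\sigma_u(\Phi),\qquad M_V^{({}_3F_2)}=\Phi^{-1}\,\operatorname{Sym}^2\bigl(M_v^{({}_2F_1)}\bigr)\,\sigma_v(\Phi),$$ where $$\Phi=\begin{pmatrix}1&0&\dfrac{2abz}{1-z}\\[2mm]0&2&\dfrac{2((a+b)z-c+1)}{1-z}\\[2mm]0&0&2\end{pmatrix}\quad\text{with }c=a+b+\tfrac12.$$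
   Context: $\theta=z\,\frac{d}{dz}$. With $B_f=(f,\theta f)$ the restricted Gauss-CMF generators are the $2\times2$ matrices of rational functions with $B_fM_u^{({}_2F_1)}=\sigma_u(B_f)$ and $B_fM_v^{({}_2F_1)}=\sigma_v(B_f)$, where on the hyperplane $c=a+b+\tfrac12$ the shift $\sigma_u$ acts by $a\mapsto a+1$ and $\sigma_v$ by $b\mapsto b+1$ (with $c\mapsto c+1$ in both cases). Likewise, with $B_h=(h,\theta h,\theta^2h)$, the ${}_3F_2$ generators satisfy $B_hM_U^{({}_3F_2)}=\sigma_U(B_h)$, $B_hM_V^{({}_3F_2)}=\sigma_V(B_h)$, where $\sigma_U,\sigma_V$ shift the parameters $(2a,2b,a+b;2a+2b,a+b+\tfrac12)$ by $U$, $V$. One works away from the rank-drop locus, i.e. the entries of $(f^2,f\theta f,(\theta f)^2)$ and of $B_h$ are bases of the rank-$3$ module generated by $h$ over rational functions. For a $2\times2$ matrix acting on a row basis by right multiplication, $$\operatorname{Sym}^2\begin{pmatrix} p & q \\ r & s \end{pmatrix}=\begin{pmatrix} p^2 & pq & q^2 \\ 2pr & ps+qr & 2qs \\ r^2 & rs & s^2 \end{pmatrix}.$$ *)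

(* Defs.v *)
From mathcomp Require Import all_boot all_order all_algebra.
From mathcomp Require Import all_classical all_reals topology normedtype sequences derive.
From mathcomp Require Import complex.
From mathcomp Require Import -(notations) mpoly.

Set Implicit Arguments.
Unset Strict Implicit.
Unset Printing Implicit Defensive.

Import Order.TTheory GRing.Theory Num.Theory numFieldNormedType.Exports.
Local Open Scope ring_scope.
Local Open Scope quotient_scope.
Local Open Scope complex_scope.

Definition rowl (K : nmodType) (n : nat) (s : seq K) : 'rV[K]_n :=
  \row_(j < n) s`_j.

Definition mxl (K : nmodType) (m n : nat) (s : seq (seq K)) : 'M[K]_(m, n) :=
  \matrix_(i < m, j < n) (nth [::] s i)`_j.

Definition poch (K : pzRingType) (x : K) (n : nat) : K :=
  \prod_(i < n) (x + i%:R).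

(* pFq(A; B; z), meaningful for |z| < 1 when no entry of B is a nonpositive
   integer. *)
Definition hyp (R : realType) (p q : nat) (A : 'rV[R[i]]_p) (B : 'rV[R[i]]_q)
    (z : R[i]) : R[i] :=
  limn (series (fun n : nat =>
    (\prod_(i < p) poch (A 0 i) n)
      / ((\prod_(j < q) poch (B 0 j) n) * n`!%:R) * z ^+ n : R[i]^o)).

Definition theta (R : realType) (g : R[i] -> R[i]) : R[i] -> R[i] :=
  fun z => z * derive1 (g : R[i]^o -> R[i]^o) z.

Definition theta_row (R : realType) (n : nat) (g : R[i] -> R[i]) (z : R[i]) :
    'rV[R[i]]_n :=
  \row_(k < n) iter k (@theta R) g z.

(* The parameters are split into upper and lower ones: a point of the Gauss  *)
(* hyperplane c = a + b + 1/2 is (gauss_up a b; gauss_lo a b).               *)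
Definition gauss_up (R : realType) (a b : R[i]) : 'rV[R[i]]_2 :=
  rowl 2 [:: a; b].
Definition gauss_lo (R : realType) (a b : R[i]) : 'rV[R[i]]_1 :=
  rowl 1 [:: a + b + 2^-1].
Definition clausen_up (R : realType) (a b : R[i]) : 'rV[R[i]]_3 :=
  rowl 3 [:: 2 * a; 2 * b; a + b].
Definition clausen_lo (R : realType) (a b : R[i]) : 'rV[R[i]]_2 :=
  rowl 2 [:: 2 * a + 2 * b; a + b + 2^-1].

Definition f (R : realType) (a b : R[i]) : R[i] -> R[i] :=
  hyp (gauss_up a b) (gauss_lo a b).
Definition h (R : realType) (a b : R[i]) : R[i] -> R[i] :=
  hyp (clausen_up a b) (clausen_lo a b).

Definition dom (R : realType) (a b z : R[i]) : Prop :=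
  [/\ forall (j : 'I_1) (n : nat), gauss_lo a b 0 j != - n%:R,
      forall (j : 'I_2) (n : nat), clausen_lo a b 0 j != - n%:R
    & `|z| < 1].

Definition rowfam (R : realType) (n : nat) : Type :=
  R[i] -> R[i] -> R[i] -> 'rV[R[i]]_n.

Definition Bf (R : realType) : rowfam R 2 := fun a b => theta_row 2 (f a b).
Definition Bh (R : realType) : rowfam R 3 := fun a b => theta_row 3 (h a b).

(* sigma_s(B_f) for the shift s = (sup; slo) of the parameters (a, b; c). *)
Definition shift_Bf (R : realType) (sup : 'rV[R[i]]_2) (slo : 'rV[R[i]]_1) :
    rowfam R 2 :=
  fun a b => theta_row 2 (hyp (gauss_up a b + sup) (gauss_lo a b + slo)).

Definition shift_Bh (R : realType) (sup : 'rV[R[i]]_3) (slo : 'rV[R[i]]_2) :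
    rowfam R 3 :=
  fun a b => theta_row 3 (hyp (clausen_up a b + sup) (clausen_lo a b + slo)).

(* u = (1,0;1), v = (0,1;1), U = (2,0,1;2,1), V = (0,2,1;2,1). *)
Definition sigma_u_Bf (R : realType) : rowfam R 2 :=
  shift_Bf (rowl 2 [:: 1; 0]) (rowl 1 [:: 1]).
Definition sigma_v_Bf (R : realType) : rowfam R 2 :=
  shift_Bf (rowl 2 [:: 0; 1]) (rowl 1 [:: 1]).
Definition sigma_U_Bh (R : realType) : rowfam R 3 :=
  shift_Bh (rowl 3 [:: 2; 0; 1]) (rowl 2 [:: 2; 1]).
Definition sigma_V_Bh (R : realType) : rowfam R 3 :=
  shift_Bh (rowl 3 [:: 0; 2; 1]) (rowl 2 [:: 2; 1]).

Definition Sf (R : realType) : rowfam R 3 := fun a b z =>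
  rowl 3 [:: f a b z ^+ 2; f a b z * theta (f a b) z; theta (f a b) z ^+ 2].

Definition ratfun (R : realType) : fieldType :=
  {fraction (mpoly 3 R[i])}.

Definition var (R : realType) (k : 'I_3) : mpoly 3 R[i] :=
  mpolyX R[i] (mnm1 k).

Definition ra (R : realType) : ratfun R := tofrac (var R (inord 0)).
Definition rb (R : realType) : ratfun R := tofrac (var R (inord 1)).
Definition rz (R : realType) : ratfun R := tofrac (var R (inord 2)).

Definition point (R : realType) (a b z : R[i]) : 'I_3 -> R[i] :=
  fun k => [:: a; b; z]`_k.

(* r is regular at (a, b, z), with value w there. *)
Definition has_value (R : realType) (r : ratfun R) (a b z w : R[i]) : Prop :=
  exists p q : mpoly 3 R[i],
    [/\ meval (point a b z) q != 0,
        r = tofrac p / tofrac q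
      & w = meval (point a b z) p / meval (point a b z) q].

(* B M = T, as an identity of functions on dom away from the poles of M. *)
Definition acts (R : realType) (m n : nat) (B : rowfam R m)
    (M : 'M[ratfun R]_(m, n)) (T : rowfam R n) : Prop :=
  forall (a b z : R[i]) (N : 'M[R[i]]_(m, n)), dom a b z ->
    (forall i j, has_value (M i j) a b z (N i j)) -> B a b z *m N = T a b z.

Definition lin_indep (R : realType) (n : nat) (B : rowfam R n) : Prop :=
  forall w : 'cV[ratfun R]_n, acts B w (fun _ _ _ => 0) -> w = 0.

(* The entries of B form a basis of the module generated by h over C(a,b,z), *)
(* i.e. of the span of all theta^k h.                                        *)
Definition basis_of_h_module (R : realType) (n : nat) (B : rowfam R n) : Prop :=
  [/\ lin_indep B,
      forall m : nat, exists W : 'M[ratfun R]_(n, m),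
        acts B W (fun a b => theta_row m (h a b))
    & exists (m : nat) (W : 'M[ratfun R]_(m, n)),
        acts (fun a b => theta_row m (h a b)) W B].

(* Substitution of polynomials s for (a, b, z), on rational functions. It is *)
(* only meant for invertible substitutions, for which the image of a         *)
(* denominator is again nonzero.                                             *)
Definition ratsubst (R : realType) (s : 3.-tuple (mpoly 3 R[i]))
    (r : ratfun R) : ratfun R :=
  tofrac (comp_mpoly s \n_(repr r))
    / tofrac (comp_mpoly s \d_(repr r)).

Definition sigma_u (R : realType) : ratfun R -> ratfun R :=
  ratsubst [tuple var R (inord 0) + 1; var R (inord 1); var R (inord 2)].
Definition sigma_v (R : realType) : ratfun R -> ratfun R :=
  ratsubst [tuple var R (inord 0); var R (inord 1) + 1; var R (inord 2)].

Definition Sym2 (K : comPzRingType) (M : 'M[K]_2) : 'M[K]_3 :=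
  let p := M 0 0 in let q := M 0 1 in let r := M 1 0 in let s := M 1 1 in
  mxl 3 3 [:: [:: p ^+ 2;      p * q;         q ^+ 2];
              [:: 2 * p * r;   p * s + q * r; 2 * q * s];
              [:: r ^+ 2;      r * s;         s ^+ 2]].

Definition Phi (R : realType) : 'M[ratfun R]_3 :=
  let a := ra R in let b := rb R in let z := rz R in
  let c := a + b + 2^-1 in
  mxl 3 3 [:: [:: 1; 0; 2 * a * b * z / (1 - z)];
              [:: 0; 2; 2 * ((a + b) * z - c + 1) / (1 - z)];
              [:: 0; 0; 2]].

Lemma Phi_unit (R : realType) : Phi R \in unitmx.
Proof.
have nz2 : (2 : ratfun R) != 0.
  rewrite -(rmorph_nat (@tofrac _)) tofrac_eq0 -mpolyC_nat mpolyC_eq0.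
  by rewrite pnatr_eq0.
rewrite unitmxE -det_tr det_trig.
  by rewrite !big_ord_recl big_ord0 !mxE /= mul1r mulr1 unitfE mulf_neq0.
apply/is_trig_mxP => i j; rewrite !mxE.
by case: i j => [[|[|[|?]]] ?] [[|[|[|?]]] ?].
Qed.

(* Main.v *)
Require Import Defs.
From mathcomp Require Import all_boot all_order all_algebra.
From mathcomp Require Import all_classical all_reals topology normedtype.
From mathcomp Require Import sequences derive complex ring lra.
From mathcomp Require Import -(notations) mpoly.
Import Order.TTheory GRing.Theory Num.Theory numFieldNormedType.Exports.
Import ComplexField.Normc.
Local Open Scope ring_scope.
Local Open Scope complex_scope.


(** Write S for the row (f^2, f theta f, (theta f)^2), B for the row
    (h, theta h, theta^2 h), and sigma for one of the two shifts.

    _Clausen's formula._ If f is annihilated by the Gauss operator, then f^2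
    is annihilated by its symmetric square, an operator of order three.  On
    the hyperplane c = a + b + 1/2 this operator is the one of the 3F2 series
    h: applied to a square, the latter is a combination of the Gauss
    expression and its theta-derivative [clausen_op_sqr].  On
    coefficients it amounts to a two-term recurrence, which f^2
    [cauchy_prod_sqr_recurrence] thus shares with h; as the initial values are
    the same, so are all the coefficients [clausen_coef].  On the unit disc,
    products and theta-derivatives of power series may be computed on
    coefficients [hasSum_cauchy_prod], [theta_power_series], so that h = f^2
    there [clausen_formula].

    _The matrix Phi._ Differentiating h = f^2 twice gives theta h =
    2 f theta f and theta^2 h = 2 (theta f)^2 + 2 f theta^2 f.  Eliminating
    theta^2 f by the Gauss equation [gauss_ode] gives B = S Phi [Bh_Sf_Phi].

    _The generators._ A matrix that maps (f, theta f) to its shift maps S to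
    its shift through its symmetric square [Sf_Sym2].  Hence S Phi MU = B MU =
    sigma(B) = sigma(S) sigma(Phi) = S Sym2(Mu) sigma(Phi), and the
    independence of S over the rational functions gives Phi MU =
    Sym2(Mu) sigma(Phi) [conjugation].

    The last step needs care about poles.  The relation between the entries
    of S is known only where the generators are regular, while independence
    asks for it wherever its own coefficients are regular, and cancellation
    may make this a larger set.  Multiplying the coefficients by the square of
    a common denominator turns them into polynomials that vanish at all the
    points in doubt [lin_indep_generic]. *)

Set Implicit Arguments.
Unset Strict Implicit.
Unset Printing Implicit Defensive.

(** * The symmetric square of the Gauss operator *)

Section Operators.
Variables (A : comNzRingType) (D : A -> A) (X a b c : A).

(** With D = theta and X = z, this is theta (theta + c - 1) - z (theta + a)
    (theta + b), with the terms in theta^2 collected. *)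
Definition gauss_op p : A :=
  (1 - X) * D (D p) - ((a + b) * X - (c - 1)) * D p - a * b * X * p.

(** The expansion of
    theta (theta + 2 (c - 1)) (theta + c - 1)
      - z (theta + 2 a) (theta + 2 b) (theta + a + b).
    Since 2 (c - 1) = 2 a + 2 b - 1 on the hyperplane, it is the operator of
    the series h there. *)
Definition clausen_op g : A :=
  let g1 := D g in let g2 := D g1 in let g3 := D g2 in
  g3 + 3 * (c - 1) * g2 + 2 * (c - 1) ^+ 2 * g1
  - X * (g3 + 3 * (a + b) * g2 + (4 * a * b + 2 * (a + b) ^+ 2) * g1
         + 4 * a * b * (a + b) * g).

(** This identity is why f^2 solves the equation of h.  It holds in any
    differential ring, so it applies to truncated power series as well as to
    functions.  The factors on the right come from the terms p D^3 p,
    D p D^2 p and p D^2 p of the left-hand side, compared in this order. *)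
Lemma clausen_op_sqr (DD : {morph D : x y / x + y})
    (DM : forall x y, D (x * y) = D x * y + x * D y) (DX : D X = X)
    (Da : D a = 0) (Db : D b = 0) (Dc : D c = 0)
    (cE : 2 * c = 2 * (a + b) + 1) p :
  clausen_op (p ^+ 2) = 2 * p * D (gauss_op p) + 6 * D p * gauss_op p
    + 4 * (c - 1) * p * gauss_op p.
Proof.
have D1 : D 1 = 0.
  by have /eqP := DM 1 1; rewrite !mulr1 mul1r -subr_eq subrr eq_sym => /eqP.
have D0 : D 0 = 0.
  by have /eqP := DD 0 0; rewrite !addr0 -subr_eq subrr eq_sym => /eqP.
have DN x : D (- x) = - D x.
  by apply/eqP; rewrite -addr_eq0 -DD addNr D0.
(* The difference of the two sides is the equation of the hyperplane times
   an explicit cofactor. *)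
apply/eqP; rewrite -subr_eq0; apply/eqP.
transitivity ((2 * c - (2 * (a + b) + 1))
  * (2 * X * p * (D (D p) + (a + b) * D p + a * b * p))); last first.
  by rewrite cE subrr mul0r.
rewrite /clausen_op /gauss_op !expr2 !(DM, DD, DN, DX, Da, Db, Dc, D1, D0).
ring.
Qed.
End Operators.

(** * Squares of Gauss coefficient sequences *)

Section Euler.
Variable K : comNzRingType.
Implicit Types p q : {poly K}.

Definition euler p : {poly K} := 'X * p^`().

Lemma eulerD : {morph euler : p q / p + q}.
Proof. by move=> p q; rewrite /euler derivD mulrDr. Qed.

Lemma eulerM p q : euler (p * q) = euler p * q + p * euler q.
Proof. by rewrite /euler derivM; ring. Qed.

Lemma eulerC (x : K) : euler x%:P = 0.
Proof. by rewrite /euler derivC mulr0. Qed.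

Lemma eulerX : euler 'X = 'X.
Proof. by rewrite /euler derivX mulr1. Qed.

Lemma coef_euler p n : (euler p)`_n = n%:R * p`_n.
Proof.
rewrite /euler coefXM coef_deriv mulr_natl.
by case: n => [|n] //=; rewrite mulr0n.
Qed.

(** Truncating a series to a polynomial preserves its differential equation
    only up to terms of high degree. *)
Definition vanishes_below N p := forall i, (i < N)%N -> p`_i = 0.

Lemma vanishes_belowD N p q :
  vanishes_below N p -> vanishes_below N q -> vanishes_below N (p + q).
Proof. by move=> p0 q0 i iN; rewrite coefD p0 ?q0 ?addr0. Qed.

Lemma vanishes_belowMr N p q : vanishes_below N q -> vanishes_below N (p * q).
Proof.
move=> q0 i iN; rewrite coefM big1// => j _.
by rewrite q0 ?mulr0//; apply: leq_ltn_trans iN; exact: leq_subr.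
Qed.

Lemma vanishes_below_euler N p :
  vanishes_below N p -> vanishes_below N (euler p).
Proof. by move=> p0 i iN; rewrite coef_euler p0 ?mulr0. Qed.

Definition cauchy_prod (u v : nat -> K) (n : nat) : K :=
  \sum_(i < n.+1) u i * v (n - i)%N.

(** The coefficient of degree n + 1 in [clausen_op_sqr], applied to the
    truncation p of the series with coefficients t: the recurrence of t makes
    the Gauss expression of p vanish in low degrees, hence also the Clausen
    expression of p^2, whose low-degree coefficients are those of the Cauchy
    square. *)
Lemma cauchy_prod_sqr_recurrence (a b c : K) (t : nat -> K) :
  2 * c = 2 * (a + b) + 1 ->
  (forall n, (n.+1)%:R * (c + n%:R) * t n.+1 = (a + n%:R) * (b + n%:R) * t n) ->
  forall n,
    (n.+1)%:R * (2 * a + 2 * b + n%:R) * (c + n%:R) * cauchy_prod t t n.+1 =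
    (2 * a + n%:R) * (2 * b + n%:R) * (a + b + n%:R) * cauchy_prod t t n.
Proof.
move=> cE t_rec n; pose N := n.+2; pose p : {poly K} := \poly_(i < N) t i.
have gauss_p : vanishes_below N (gauss_op euler 'X a%:P b%:P c%:P p).
  move=> i iN; rewrite /gauss_op !(mulrBl, mulrDl) !mul1r -!mulrA.
  rewrite !(coef_euler, coefD, coefN, coefCM, coefXM).
  case: i iN => [|i] iN /=; first by ring.
  rewrite /p !coef_poly iN (ltnW iN).
  have := t_rec i; rewrite -natr1 => e.
  by move/eqP: e; rewrite -subr_eq0 => /eqP <-; ring.
have cE' : 2 * c%:P = 2 * (a%:P + b%:P) + 1 :> {poly K}.
  by rewrite -(rmorph_nat polyC) -polyCD -!polyCM cE polyCD.
have : vanishes_below N (clausen_op euler 'X a%:P b%:P c%:P (p ^+ 2)).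
  rewrite clausen_op_sqr//; [|exact: eulerD|exact: eulerM|exact: eulerX|
    exact: eulerC..].
  apply: vanishes_belowD; first apply: vanishes_belowD.
  - by apply/vanishes_belowMr/vanishes_below_euler.
  - exact: vanishes_belowMr.
  - exact: vanishes_belowMr.
have coef_sqr i : (i < N)%N -> (p ^+ 2)`_i = cauchy_prod t t i.
  move=> iN; rewrite expr2 coefM; apply: eq_bigr => j _.
  rewrite /p !coef_poly (leq_trans (ltn_ord j))// ifT//.
  exact: leq_ltn_trans (leq_subr _ _) iN.
move=> /(_ n.+1 (ltnSn _)).
rewrite /clausen_op -(rmorph_nat polyC 2) -(rmorph_nat polyC 3).
rewrite -(rmorph_nat polyC 4) -polyC1.
rewrite -!(polyCD, polyCN, polyCM, polyC_exp).
rewrite !(coef_euler, coefD, coefN, coefCM, coefXM) /= !coef_sqr//.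
rewrite -natr1.
set s := cauchy_prod t t n.+1; set s' := cauchy_prod t t n.
have -> : 2 * a + 2 * b = 2 * c - 1 by rewrite cE; ring.
by move=> e; apply/eqP; rewrite -subr_eq0 -[X in _ == X]e; apply/eqP; ring.
Qed.

End Euler.

(** * Complex sequences and series *)

Local Notation Re := complex.Re.
Local Notation Im := complex.Im.

Section Modulus.
Local Open Scope classical_set_scope.
Variable R : realType.
Implicit Types x y : R[i].

Lemma normC_normc x : `|x| = (normc x)%:C.
Proof. by []. Qed.

Lemma normc_ge0 x : 0 <= normc x.
Proof. by rewrite -lecR; exact: (normr_ge0 x). Qed.

Lemma normcX x n : normc (x ^+ n) = normc x ^+ n.
Proof. by elim: n => [|n IH]; rewrite ?expr0 ?normc1// !exprS normcM IH. Qed.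

Lemma normc_nat n : normc (n%:R : R[i]) = n%:R.
Proof.
by apply: (@complexI R); rewrite -normC_normc normr_nat rmorph_nat.
Qed.

Lemma normc_sum (I : Type) (s : seq I) (P : pred I) (F : I -> R[i]) :
  normc (\sum_(i <- s | P i) F i) <= \sum_(i <- s | P i) normc (F i).
Proof.
elim/big_rec2: _ => [|i y x _ le_xy]; first by rewrite normc0.
exact: le_trans (le_normcD _ _) (lerD (lexx _) le_xy).
Qed.

Lemma normc_le_ReIm x : normc x <= `|Re x| + `|Im x|.
Proof.
rewrite -[leRHS]ger0_norm ?addr_ge0// -sqrtr_sqr; case: x => a b /=.
rewrite ler_wsqrtr// sqrrD !real_normK ?num_real// lerD2r lerDl.
by rewrite mulrn_wge0 ?mulr_ge0.
Qed.

Lemma Re_le_normc x : `|Re x| <= normc x.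
Proof. by rewrite -lecR; exact: normc_ge_Re. Qed.

Lemma Im_le_normc x : `|Im x| <= normc x.
Proof.
case: x => a b /=; rewrite -sqrtr_sqr ler_wsqrtr// lerDr.
exact: sqr_ge0.
Qed.

Lemma ReB x y : Re (x - y) = Re x - Re y.
Proof. by case: x y => [a b] [c d]. Qed.

Lemma ImB x y : Im (x - y) = Im x - Im y.
Proof. by case: x y => [a b] [c d]. Qed.

Lemma Re_sum (I : Type) (s : seq I) (F : I -> R[i]) :
  Re (\sum_(i <- s) F i) = \sum_(i <- s) Re (F i).
Proof.
by elim/big_rec2: _ => // i x y _ <-; case: (F i) y => [a b] [c d].
Qed.

Lemma Im_sum (I : Type) (s : seq I) (F : I -> R[i]) :
  Im (\sum_(i <- s) F i) = \sum_(i <- s) Im (F i).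
Proof.
by elim/big_rec2: _ => // i x y _ <-; case: (F i) y => [a b] [c d].
Qed.

(** The norm of R[i] takes its values in R[i]; the estimates below are made
    with the real-valued modulus instead. *)
Lemma cvgC_lt (F : set_system nat) (FF : Filter F) (u : nat -> R[i]^o)
    (l : R[i]^o) :
  u @ F --> l <-> forall e : R, 0 < e -> \forall n \near F, normc (l - u n) < e.
Proof.
split=> [/cvgrPdist_lt ul e e0|ul].
  have := ul e%:C; rewrite ltcR => /(_ e0); apply: filterS => n.
  by rewrite normC_normc ltcR.
apply/cvgrPdist_lt => e; rewrite ltcE/= => /andP[/eqP Ime /ul].
apply: filterS => n une.
have -> : e = (Re e)%:C by case: e Ime {ul une} => ? ? /= ->.
by rewrite normC_normc ltcR.
Qed.

Lemma cvgC_squeeze (u : nat -> R[i]^o) (l : R[i]^o) (v : nat -> R) :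
  v @ \oo --> (0 : R) -> (forall n, normc (l - u n) <= v n) -> u @ \oo --> l.
Proof.
move=> v0 uv; apply/cvgC_lt => e e0.
move/cvgrPdist_lt : v0 => /(_ e e0); apply: filterS => n.
rewrite sub0r normrN; apply: le_lt_trans.
by rewrite (le_trans (uv n))// ler_norm.
Qed.
End Modulus.

Section Geometric.
Variable R : realType.
Implicit Types (q r : R).

Lemma sum_geometric_le {q} n : 0 <= q < 1 -> \sum_(k < n) q ^+ k <= (1 - q)^-1.
Proof.
move=> /andP[q0 q1]; rewrite -(ler_pM2l (_ : 0 < 1 - q)) ?subr_gt0//.
rewrite divff ?subr_eq0 ?gt_eqF// -opprB mulNr -subrX1 opprB gerBl.
exact: exprn_ge0.
Qed.

(** A linear factor is absorbed by a slightly larger ratio q' = (1 + q) / 2: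
    the sum of the first n + 1 powers of q / q' has terms at least
    (q / q')^n, and is bounded. *)
Lemma linear_geometric_le {q} : 0 <= q < 1 ->
  exists q' M, [/\ 0 <= q' < 1, 0 <= M &
    forall n, n.+1%:R * q ^+ n <= M * q' ^+ n].
Proof.
move=> /andP[q0 q1]; pose q' := (1 + q) / 2; pose r := q / q'.
have q'0 : 0 < q' by rewrite /q'; lra.
have q'1 : q' < 1 by rewrite /q'; lra.
have r01 : 0 <= r < 1.
  by rewrite divr_ge0 ?(ltW q'0)//= ltr_pdivrMr// mul1r /q'; lra.
have [r0 r1] := andP r01.
exists q', (1 - r)^-1; split; first by rewrite q'1 ltW.
  by rewrite invr_ge0 subr_ge0 ltW.
move=> n; have -> : q = r * q' by rewrite divfK// gt_eqF.
rewrite exprMn mulrA ler_wpM2r ?exprn_ge0 ?(ltW q'0)//.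
apply: le_trans (sum_geometric_le n.+1 r01).
rewrite mulr_natl -[X in _ *+ X]card_ord -sumr_const.
apply: ler_sum => i _; rewrite ler_wiXn2l ?(ltW r1)//.
by rewrite -ltnS.
Qed.
End Geometric.

Section Summation.
Local Open Scope classical_set_scope.
Variable R : realType.
Local Notation C := (R[i]).
Implicit Types (u v a b : nat -> C) (s t z : C) (q r K : R).

Local Notation psums u := (series (u : nat -> C^o)).

Definition hasSum u s := psums u @ \oo --> (s : C^o).

Lemma hasSum_lim u s : hasSum u s -> limn (psums u) = s.
Proof. by move=> us; apply: cvg_lim us; exact: norm_hausdorff. Qed.

Lemma hasSum_uniq u s t : hasSum u s -> hasSum u t -> s = t.
Proof. by move=> /hasSum_lim <- /hasSum_lim <-. Qed.

Lemma eq_hasSum u v s : u =1 v -> hasSum u s -> hasSum v s.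
Proof. by move=> /funext ->. Qed.

Lemma hasSumD u v s t : hasSum u s -> hasSum v t ->
  hasSum (fun n => u n + v n) (s + t).
Proof.
move=> us vt; rewrite /hasSum.
rewrite -[X in series X]/((u : nat -> C^o) + (v : nat -> C^o))%R seriesD.
exact: (@cvgD _ _ _ _ _ (psums u) (psums v) s t us vt).
Qed.

Lemma hasSumZ k u s : hasSum u s -> hasSum (fun n => k * u n) (k * s).
Proof.
move=> us; have kus : (fun n => k * psums u n : C^o) @ \oo --> (k * s : C^o).
  exact: (@cvgM C _ _ _ (fun=> k) (psums u) k s (@cvg_cst C^o k _ _ _) us).
rewrite /hasSum (_ : psums _ = (fun n => k * psums u n : C^o))//.
by apply/funext => n; rewrite /series /= mulr_sumr.
Qed.

(** Completeness of R[i] in the form needed here, from the convergence of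
    the real and imaginary parts. *)
Lemma hasSum_geometric u K q : 0 <= q < 1 ->
  (forall n, normc (u n) <= K * q ^+ n) -> exists s, hasSum u s.
Proof.
move=> /andP[q0 q1] uKq.
have cvg_part (p : C -> R) : (forall x, `|p x| <= normc x) ->
    cvgn (series (p \o u)).
  move=> p_le; apply: (@normed_cvg R R^o).
  apply: (@series_le_cvg _ _ (geometric K q)) => [n|n|n|].
  - exact: normr_ge0.
  - by apply: le_trans (uKq n); exact: normc_ge0.
  - exact: le_trans (p_le _) (uKq n).
  - by apply: is_cvg_geometric_series; rewrite ger0_norm.
have cRe := cvg_part _ (@Re_le_normc R).
have cIm := cvg_part _ (@Im_le_normc R).
exists (limn (series (@Re R \o u)) +i* limn (series (@Im R \o u))).
apply/cvgC_lt => e e0; have e20 : 0 < e / 2 by rewrite divr_gt0.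
move/cvgrPdist_lt : cRe => /(_ _ e20) cRe.
move/cvgrPdist_lt : cIm => /(_ _ e20) cIm.
near=> n.
set d : C := (_ - psums u n).
apply: (le_lt_trans (normc_le_ReIm d)).
rewrite [ltRHS]splitr; apply: ltrD.
  have -> : Re d = limn (series (@Re R \o u)) - series (@Re R \o u) n.
    by rewrite ReB /= /series /= Re_sum.
  by near: n.
have -> : Im d = limn (series (@Im R \o u)) - series (@Im R \o u) n.
  by rewrite ImB /= /series /= Im_sum.
by near: n.
Unshelve. all: by end_near. Qed.

Lemma hasSum_le u s K : (forall n, normc (\sum_(k < n) u k) <= K) ->
  hasSum u s -> normc s <= K.
Proof.
move=> uK /cvgC_lt us; rewrite leNgt; apply/negP => Ks.
have [N _ /(_ N (leqnn N))] := us _ (etrans (subr_gt0 _ _) Ks).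
rewrite /series /= big_mkord ltNge => /negP; apply.
rewrite lerBlDr -[X in normc X <= _](subrK (\sum_(k < N) u k)).
by apply: le_trans (le_normcD _ _) _; rewrite lerD.
Qed.

Lemma hasSum_geometric_le u s K q : 0 <= q < 1 ->
  (forall n, normc (u n) <= K * q ^+ n) -> hasSum u s -> normc s <= K / (1 - q).
Proof.
move=> q01 uK; apply: hasSum_le => n; apply: le_trans (normc_sum _ _ _) _.
have K0 : 0 <= K.
  by have := le_trans (normc_ge0 _) (uK 0%N); rewrite expr0 mulr1.
apply: le_trans (ler_sum _ (fun (i : 'I_n) _ => uK i)) _.
by rewrite -mulr_sumr ler_wpM2l// sum_geometric_le.
Qed.

(** The product of the partial sums up to N differs from the partial sum of
    the Cauchy product by the terms u_i v_j with i, j < N <= i + j, which are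
    at most a geometric tail.  The partial sums are handled as the values at
    1 of the truncations p and r. *)
Lemma hasSum_cauchy_prod_geometric u v s t K K' q : 0 <= q < 1 ->
  (forall n, normc (u n) <= K * q ^+ n) ->
  (forall n, normc (v n) <= K' * q ^+ n) ->
  hasSum u s -> hasSum v t -> hasSum (cauchy_prod u v) (s * t).
Proof.
move=> q01 uK vK us vt; have [q0 q1] := andP q01.
have [q' [M [q'01 M0 qM]]] := linear_geometric_le q01.
have [q'0 q'1] := andP q'01.
have K0 : 0 <= K.
  by have := le_trans (normc_ge0 _) (uK 0%N); rewrite expr0 mulr1.
have K'0 : 0 <= K'.
  by have := le_trans (normc_ge0 _) (vK 0%N); rewrite expr0 mulr1.
have square_sub N :
    normc (psums u N * psums v N - psums (cauchy_prod u v) N) <=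
    K * K' * M / (1 - q') * q' ^+ N.
  pose p := \poly_(i < N) u i; pose r := \poly_(i < N) v i.
  have -> : psums u N * psums v N = \sum_(n < N + N) (p * r)`_n.
    transitivity ((p * r).[1]).
      rewrite hornerM !horner_poly /series /= !big_mkord.
      by congr (_ * _); apply: eq_bigr => i _; rewrite expr1n mulr1.
    rewrite (@horner_coef_wide _ (N + N)).
      by apply: eq_bigr => i _; rewrite expr1n mulr1.
    apply: leq_trans (size_polyMleq _ _) _.
    by rewrite (leq_trans (leq_pred _))// leq_add ?size_poly.
  rewrite big_split_ord /series /= big_mkord addrAC -sumrB.
  rewrite big1 ?add0r; last first.
    move=> n _; rewrite coefM.
    apply/eqP; rewrite subr_eq0; apply/eqP; apply: eq_bigr => i _.
    rewrite !coef_poly (leq_trans (ltn_ord i))// ifT//.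
    exact: leq_ltn_trans (leq_subr _ _) (ltn_ord n).
  have coef_le n : normc (p * r)`_n <= K * K' * M * q' ^+ n.
    rewrite coefM; apply: le_trans (normc_sum _ _ _) _.
    rewrite -mulrA; apply: le_trans (ler_wpM2l (mulr_ge0 K0 K'0) (qM n)).
    rewrite [leRHS]mulrCA -[X in X%:R]card_ord mulr_natl -sumr_const.
    apply: ler_sum => i _; rewrite normcM.
    have part_le (w : nat -> C) L j : 0 <= L ->
        (forall n, normc (w n) <= L * q ^+ n) ->
        normc (\poly_(i < N) w i)`_j <= L * q ^+ j.
      move=> L0 wL; rewrite coef_poly; case: ifP => // _.
      by rewrite normc0 mulr_ge0// exprn_ge0.
    have iq : q ^+ n = q ^+ i * q ^+ (n - i)%N.
      by rewrite -exprD subnKC// -ltnS.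
    rewrite iq mulrACA; apply: ler_pM; rewrite ?normc_ge0//; exact: part_le.
  apply: le_trans (normc_sum _ _ _) _.
  apply: le_trans (ler_sum _ (fun (i : 'I_N) _ => coef_le (N + i)%N)) _.
  rewrite -mulr_sumr -!mulrA ler_wpM2l// ler_wpM2l// ler_wpM2l//.
  rewrite (eq_bigr (fun i : 'I_N => q' ^+ i * q' ^+ N)) => [|i _]; last first.
    by rewrite exprD mulrC.
  by rewrite -mulr_suml ler_wpM2r ?exprn_ge0// sum_geometric_le.
have st : (fun n => psums u n * psums v n) @ \oo
    --> (s * t : C^o) by exact: (@cvgM _ _ _ _ _ _ s t us vt).
rewrite /hasSum -[s * t]subr0.
rewrite (_ : psums _ = (fun n => psums u n * psums v n
   - (psums u n * psums v n - psums (cauchy_prod u v) n))); last first.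
  by apply/funext => n; rewrite subKr.
apply: (@cvgB _ _ _ _ _ _ _ (s * t : C^o) 0 st).
apply: (@cvgC_squeeze _ _ _ (geometric (K * K' * M / (1 - q')) q')).
  by apply: cvg_geometric; rewrite ger0_norm.
by move=> n; rewrite sub0r normcN.
Qed.
End Summation.

Arguments hasSumZ {R} k {u s}.

(** * Power series on the unit disc *)

Section Tame.
Local Open Scope classical_set_scope.
Variable R : realType.
Local Notation C := (R[i]).
Implicit Types (a b : nat -> C) (s t z h : C) (q r K : R).

(** Radius of convergence at least 1, in a form stable under the operations
    on coefficients. *)
Definition tame a := forall r, 0 <= r < 1 ->
  exists K, forall n, normc (a n) * r ^+ n <= K.

(** The ratio q depends on the radius r only, so that two series can be
    compared to the same geometric series. *)
Lemma tame_geometric r : 0 <= r < 1 -> exists2 q, 0 <= q < 1 &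
  forall a, tame a -> exists2 K, 0 <= K &
    forall n, normc (a n) * r ^+ n <= K * q ^+ n.
Proof.
move=> /andP[r0 r1]; pose r' := (1 + r) / 2.
have r'0 : 0 < r' by rewrite /r'; lra.
exists (r / r').
  by rewrite divr_ge0 ?(ltW r'0)//= ltr_pdivrMr// mul1r /r'; lra.
move=> a /(_ r')[|K aK]; first by rewrite (ltW r'0) /r'; lra.
exists K.
  by have := aK 0%N; rewrite expr0 mulr1; apply: le_trans; exact: normc_ge0.
move=> n; rewrite -[in leLHS](divfK (lt0r_neq0 r'0) r) exprMn.
by rewrite mulrCA mulrC ler_wpM2r// exprn_ge0// divr_ge0// ltW.
Qed.

Lemma tame_natM a : tame a -> tame (fun n => n%:R * a n).
Proof.
move=> ta r /tame_geometric[q /[dup] q01 /linear_geometric_le].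
have [q0 q1] := andP q01.
move=> [q' [M [/andP[q'0 q'1] M0 qM]]] /(_ _ ta)[K K0 aK]; exists (K * M) => n.
rewrite normcM normc_nat -mulrA.
apply: le_trans (ler_wpM2l (ler0n _ n) (aK n)) _.
rewrite mulrCA ler_wpM2l//.
apply: (@le_trans _ _ (n.+1%:R * q ^+ n)).
  by rewrite ler_wpM2r ?exprn_ge0// ler_nat.
apply: le_trans (qM n) _; rewrite ler_piMr//.
by apply: exprn_ile1; rewrite ?(ltW q'1).
Qed.

(** Terms are bounded at the radius r because those of each factor are bounded
    at the radius sqrt r. *)
Lemma tameM a b : tame a -> tame b -> tame (fun n => a n * b n).
Proof.
move=> ta tb r /andP[r0 r1]; pose s := Num.sqrt r.
have s01 : 0 <= s < 1.
  by rewrite sqrtr_ge0 -[ltRHS]sqrtr1 ltr_sqrt.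
have [[K aK] [K' bK]] := (ta s s01, tb s s01).
exists (K * K') => n; rewrite normcM -[in leLHS](sqr_sqrtr r0) -/s.
rewrite exprAC expr2 mulrACA.
have s0 : 0 <= s ^+ n by rewrite exprn_ge0// sqrtr_ge0.
by apply: ler_pM; rewrite ?mulr_ge0// normc_ge0.
Qed.

Lemma eq_tame a b : a =1 b -> tame a -> tame b.
Proof. by move=> /funext ->. Qed.

Lemma tame_prod m (F : 'I_m -> nat -> C) :
  (forall i, tame (F i)) -> tame (fun n => \prod_(i < m) F i n).
Proof.
elim: m F => [|m IH] F tF.
  apply: (@eq_tame (fun=> 1)) => [n|r /andP[r0 r1]]; first by rewrite big_ord0.
  by exists 1 => n; rewrite normc1 mul1r; apply: exprn_ile1; rewrite ?(ltW r1).
apply: (@eq_tame (fun n => F ord0 n * \prod_(i < m) F (lift ord0 i) n)).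
  by move=> n; rewrite big_ord_recl.
by apply: tameM => //; exact: IH.
Qed.

Lemma hasSum_tame a z : tame a -> normc z < 1 ->
  exists s, hasSum (fun n => a n * z ^+ n) s.
Proof.
move=> ta z1; have [|q q01 /(_ _ ta)[K _ aK]] := @tame_geometric (normc z).
  by rewrite normc_ge0.
apply: (@hasSum_geometric _ _ K q q01) => n.
by rewrite normcM normcX.
Qed.

Lemma hasSum_cauchy_prod a b z s t : tame a -> tame b -> normc z < 1 ->
  hasSum (fun n => a n * z ^+ n) s -> hasSum (fun n => b n * z ^+ n) t ->
  hasSum (fun n => cauchy_prod a b n * z ^+ n) (s * t).
Proof.
move=> ta tb z1 sa sb; have [|q q01 tq] := @tame_geometric (normc z).
  by rewrite normc_ge0.
have [[K _ aK] [K' _ bK]] := (tq _ ta, tq _ tb).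
apply: (@eq_hasSum _
  (cauchy_prod (fun n => a n * z ^+ n) (fun n => b n * z ^+ n))).
  move=> n; rewrite /cauchy_prod mulr_suml; apply: eq_bigr => i _.
  by rewrite mulrACA -exprD subnKC// -ltnS.
by apply: (@hasSum_cauchy_prod_geometric _ _ _ _ _ K K' q) => // n;
  rewrite normcM normcX.
Qed.

(** The factor r^2 on the left avoids the exponent n - 2.  Induction on n:
    the remainder of degree n + 1 is z + h times that of degree n, plus
    n z^(n - 1) h^2. *)
Lemma taylor2_le z h r n : 0 <= r -> normc z <= r -> normc (z + h) <= r ->
  normc ((z + h) ^+ n - z ^+ n - n%:R * z ^+ n.-1 * h) * r ^+ 2
    <= n%:R ^+ 2 * r ^+ n * normc h ^+ 2.
Proof.
move=> r0 zr zhr; elim: n => [|n IH].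
  by rewrite !expr0 subrr !mul0r subr0 normc0 mul0r expr0n !mul0r.
pose D := (z + h) ^+ n - z ^+ n - n%:R * z ^+ n.-1 * h.
have -> : (z + h) ^+ n.+1 - z ^+ n.+1 - n.+1%:R * z ^+ n.+1.-1 * h
    = (z + h) * D + n%:R * z ^+ n.-1 * h ^+ 2.
  rewrite /D /= !exprS -natr1; case: n {IH D} => [|n] /=; first by ring.
  by rewrite !exprS; ring.
apply: le_trans (ler_wpM2r (exprn_ge0 _ r0) (le_normcD _ _)) _.
rewrite !normcM mulrDl normc_nat !normcX.
have -> : n.+1%:R ^+ 2 * r ^+ n.+1 * normc h ^+ 2
   = r * (n%:R ^+ 2 * r ^+ n * normc h ^+ 2)
     + n%:R * r ^+ n.+1 * normc h ^+ 2
     + n.+1%:R * r ^+ n.+1 * normc h ^+ 2 by rewrite -natr1 (exprS r n); ring.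
rewrite -[leLHS]addr0; apply: lerD; last first.
  by rewrite !mulr_ge0 ?exprn_ge0 ?normc_ge0.
apply: lerD.
  rewrite -[leLHS]mulrA; apply: ler_pM => //; rewrite ?normc_ge0//.
  by rewrite mulr_ge0 ?normc_ge0 ?exprn_ge0.
rewrite mulrAC ler_wpM2r ?mulr_ge0 ?normc_ge0//.
case: n {IH D} => [|n] /=; first by rewrite !mul0r.
rewrite -mulrA ler_wpM2l// -[n.+2]addn2 exprD ler_wpM2r ?exprn_ge0//.
by rewrite lerXn2r ?nnegrE ?normc_ge0.
Qed.

(** Termwise differentiation.  By [taylor2_le], the increment of g minus the
    candidate d * h is O(h^2), because n^2 a_n r^n is dominated by a
    geometric sequence for a radius r strictly between the modulus of z
    and 1. *)
Lemma theta_power_series a (g : C -> C) : tame a ->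
  (forall z, normc z < 1 -> hasSum (fun n => a n * z ^+ n) (g z)) ->
  forall z, normc z < 1 ->
    hasSum (fun n => n%:R * a n * z ^+ n) (theta g z).
Proof.
move=> ta ag z z1; pose r := (1 + normc z) / 2.
have z0 := normc_ge0 z.
have r0 : 0 < r by rewrite /r; lra.
have r1 : r < 1 by rewrite /r; lra.
have zr : normc z < r by rewrite /r; lra.
have [|q q01 tq] := @tame_geometric r; first by rewrite r1 ltW.
have [d da] : exists d, hasSum (fun n => n%:R * a n * z ^+ n.-1) d.
  have [K K0 aK] := tq _ (tame_natM ta).
  apply: (@hasSum_geometric _ _ (K / r) q q01) => n.
  rewrite [leRHS]mulrAC ler_pdivlMr//; apply: le_trans (aK n).
  case: n => [|n] /=; first by rewrite !mul0r normc0 !mul0r.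
  rewrite normcM -mulrA ler_wpM2l ?normc_ge0// normcX exprSr.
  by rewrite ler_wpM2r ?(ltW r0)// lerXn2r ?nnegrE ?(ltW r0)// ltW.
suff -> : theta g z = z * d.
  have := hasSumZ z da; apply: eq_hasSum => -[|n] /=.
    by rewrite !mul0r mulr0.
  by rewrite exprS; ring.
rewrite /theta; congr (_ * _).
have [K K0 aK] := tq _ (tame_natM (tame_natM ta)).
have [q0 q1] := andP q01.
pose M := K / (1 - q) / r ^+ 2.
have M0 : 0 <= M by rewrite !divr_ge0 ?exprn_ge0 ?subr_ge0 ?(ltW r0) ?(ltW q1).
have diff_le h : normc (z + h) < r ->
    normc (g (z + h) - g z - d * h) <= M * normc h ^+ 2.
  move=> zhr.
  have sum_diff : hasSum
      (fun n => a n * ((z + h) ^+ n - z ^+ n - n%:R * z ^+ n.-1 * h))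
      (g (z + h) - g z - d * h).
    have := hasSumD (hasSumD (ag _ (lt_trans zhr r1)) (hasSumZ (-1) (ag _ z1)))
              (hasSumZ (- h) da).
    rewrite mulN1r mulNr (mulrC h); apply: eq_hasSum => n.
    by ring.
  have -> : M * normc h ^+ 2 = K / r ^+ 2 * normc h ^+ 2 / (1 - q).
    by rewrite /M; ring.
  apply: (hasSum_geometric_le q01 _ sum_diff) => n.
  have -> : K / r ^+ 2 * normc h ^+ 2 * q ^+ n
      = K * q ^+ n * normc h ^+ 2 / r ^+ 2 by ring.
  rewrite ler_pdivlMr ?exprn_gt0// normcM -[leLHS]mulrA.
  have := taylor2_le n (ltW r0) (ltW zr) (ltW zhr).
  move=> /(ler_wpM2l (normc_ge0 (a n))) le_taylor.
  apply: (le_trans le_taylor).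
  rewrite [leLHS]mulrA ler_wpM2r ?exprn_ge0 ?normc_ge0//.
  apply: le_trans (aK n); rewrite !normcM normc_nat le_eqVlt.
  by apply/orP; left; apply/eqP; ring.
rewrite /derive1; apply: (@cvg_lim C^o (@norm_hausdorff _ C^o) _ _ _ _ d).
apply/cvgrPdist_lt => e e0.
near=> h.
have h0 : h != 0 by near: h; exact: nbhs_dnbhs_neq.
have hr : normc (z + h) < r.
  apply: le_lt_trans (le_normcD _ _) _; rewrite addrC -ltrBrDr -ltcR.
  near: h; apply: dnbhs0_lt.
  by rewrite ltcR subr_gt0.
have he : normc h * (M + 1) < complex.Re e.
  rewrite -ltr_pdivlMr ?ltr_wpDl// -ltcR.
  near: h; apply: dnbhs0_lt.
  rewrite ltcR divr_gt0 ?ltr_wpDl//.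
  by move: e0; rewrite ltcE => /andP[].
have -> : e = (complex.Re e)%:C by rewrite RRe_real// gtr0_real.
rewrite normC_normc ltcR (addrC h z).
have -> : d - h^-1 *: (g (z + h) - g z) = - (h^-1 * (g (z + h) - g z - d * h)).
  by rewrite mulrBr opprB (mulrC d) mulKf.
rewrite normcN normcM normcV.
have nh0 : 0 < normc h.
  rewrite lt_neqAle normc_ge0 andbT eq_sym.
  by apply: contra h0 => /eqP/eq0_normc ->.
rewrite mulrC ltr_pdivrMr//; apply: le_lt_trans (diff_le _ hr) _.
apply: le_lt_trans (_ : M * normc h ^+ 2 <= (normc h * (M + 1)) * normc h) _.
  rewrite [leRHS](_ : _ = M * normc h ^+ 2 + normc h ^+ 2); last by ring.
  by rewrite lerDl exprn_ge0// ltW.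
by rewrite ltr_pM2r.
Unshelve. all: by end_near. Qed.

End Tame.

Section DiscSeries.
Local Open Scope classical_set_scope.
Variable R : realType.
Local Notation C := (R[i]).
Implicit Types (a b : nat -> C) (g k : C -> C) (z : C).

Lemma tame_cauchy_prod a b : tame a -> tame b -> tame (cauchy_prod a b).
Proof.
move=> ta tb r r01; have [q q01 tq] := tame_geometric r01.
have [[K K0 aK] [K' K'0 bK]] := (tq _ ta, tq _ tb).
have [q' [M [/andP[q'0 q'1] M0 qM]]] := linear_geometric_le q01.
have [/andP[r0 r1] /andP[q0 q1]] := (r01, q01).
exists (K * K' * M) => n.
have r_n0 m : 0 <= r ^+ m by rewrite exprn_ge0.
apply: le_trans (ler_wpM2r (r_n0 n) (normc_sum _ _ _)) _.
apply: (@le_trans _ _ (K * K' * (n.+1%:R * q ^+ n))); last first.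
  rewrite ler_wpM2l ?mulr_ge0//; apply: le_trans (qM n) _.
  by rewrite ler_piMr//; apply: exprn_ile1; rewrite ?(ltW q'1).
rewrite [leRHS]mulrCA -[X in X%:R]card_ord mulr_natl -sumr_const mulr_suml.
apply: ler_sum => i _; rewrite normcM.
have split_n (x : R) : x ^+ n = x ^+ i * x ^+ (n - i)%N.
  by rewrite -exprD subnKC// -ltnS.
rewrite !split_n mulrACA [leRHS]mulrACA.
by apply: ler_pM; rewrite ?mulr_ge0 ?normc_ge0.
Qed.

(** Nothing is asked of g outside the open unit disc: theta g is known there
    only. *)
Definition disc_series a g := tame a /\
  forall z, normc z < 1 -> hasSum (fun n => a n * z ^+ n) (g z).

Lemma disc_series_eq a g k : disc_series a g -> disc_series a k ->
  forall z, normc z < 1 -> g z = k z.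
Proof.
by move=> [_ ag] [_ ak] z z1; exact: hasSum_uniq (ag z z1) (ak z z1).
Qed.

Lemma eq_disc_series a g k : (forall z, normc z < 1 -> g z = k z) ->
  disc_series a g -> disc_series a k.
Proof. by move=> gk [ta ag]; split=> // z z1; rewrite -gk//; exact: ag. Qed.

Lemma disc_series_theta a g : disc_series a g ->
  disc_series (fun n => n%:R * a n) (theta g).
Proof.
by move=> [ta ag]; split; [exact: tame_natM|exact: theta_power_series].
Qed.

Lemma theta_eq a g k : disc_series a g ->
  (forall z, normc z < 1 -> g z = k z) ->
  forall z, normc z < 1 -> theta g z = theta k z.
Proof.
move=> ag gk; apply: (disc_series_eq (disc_series_theta ag)).
exact/disc_series_theta/(eq_disc_series gk).
Qed.

Lemma tameD a b : tame a -> tame b -> tame (fun n => a n + b n).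
Proof.
move=> ta tb r r01; have [[K aK] [K' bK]] := (ta r r01, tb r r01).
have /andP[r0 _] := r01.
exists (K + K') => n; apply: le_trans (lerD (aK n) (bK n)).
by rewrite -mulrDl ler_wpM2r ?exprn_ge0// le_normcD.
Qed.

Lemma disc_seriesD a b g k : disc_series a g -> disc_series b k ->
  disc_series (fun n => a n + b n) (fun z => g z + k z).
Proof.
move=> [ta ag] [tb bk]; split=> [|z z1]; first exact: tameD.
have := hasSumD (ag z z1) (bk z z1); apply: eq_hasSum => n.
by rewrite mulrDl.
Qed.

Lemma disc_seriesM a b g k : disc_series a g -> disc_series b k ->
  disc_series (cauchy_prod a b) (fun z => g z * k z).
Proof.
move=> [ta ag] [tb bk]; split=> [|z z1]; first exact: tame_cauchy_prod.
by apply: hasSum_cauchy_prod => //; [exact: ag|exact: bk].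
Qed.

Lemma disc_series_ext a b g : a =1 b -> disc_series a g -> disc_series b g.
Proof. by move=> /funext ->. Qed.

Lemma thetaD a b g k : disc_series a g -> disc_series b k ->
  forall z, normc z < 1 -> theta (fun z => g z + k z) z = theta g z + theta k z.
Proof.
move=> ag bk; apply: (disc_series_eq (disc_series_theta (disc_seriesD ag bk))).
have := disc_seriesD (disc_series_theta ag) (disc_series_theta bk).
by apply: disc_series_ext => n; rewrite mulrDr.
Qed.

Lemma cauchy_prod_leibniz a b n :
  n%:R * cauchy_prod a b n
  = cauchy_prod (fun i => i%:R * a i) b n
    + cauchy_prod a (fun i => i%:R * b i) n.
Proof.
rewrite /cauchy_prod mulr_sumr -big_split; apply: eq_bigr => i _.
have -> : (n%:R : C) = i%:R + (n - i)%:R by rewrite -natrD subnKC// -ltnS.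
by rewrite mulrDl /=; ring.
Qed.

Lemma thetaM a b g k : disc_series a g -> disc_series b k ->
  forall z, normc z < 1 ->
    theta (fun z => g z * k z) z = theta g z * k z + g z * theta k z.
Proof.
move=> ag bk; apply: (disc_series_eq (disc_series_theta (disc_seriesM ag bk))).
have := disc_seriesD (disc_seriesM (disc_series_theta ag) bk)
          (disc_seriesM ag (disc_series_theta bk)).
by apply: disc_series_ext => n; rewrite cauchy_prod_leibniz.
Qed.

(** Multiplication by z shifts the coefficients; this is what relates the two
    halves of a hypergeometric equation. *)
Lemma hasSum_shift (u v : nat -> C) s : v 0%N = 0 -> (forall n, v n.+1 = u n) ->
  hasSum u s -> hasSum v s.
Proof.
move=> v0 vu us; rewrite /hasSum -cvg_shiftS.
rewrite (_ : [sequence _]_n = series (u : nat -> C^o))//.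
apply/funext => n; rewrite /series /= !big_mkord big_ord_recl v0 add0r.
by apply: eq_bigr => i _; exact: vu.
Qed.
End DiscSeries.

(** * Hypergeometric series *)

Section Pochhammer.
Variable R : realType.
Local Notation C := (R[i]).

Lemma poch_succ (x : C) n : poch x n.+1 = poch x n * (x + n%:R).
Proof. by rewrite /poch big_ord_recr. Qed.

Lemma poch_neq0 (y : C) n : (forall n, y != - n%:R) -> poch y n != 0.
Proof. by move=> y0; apply/prodf_neq0 => i _; rewrite addr_eq0. Qed.

Lemma fact_poch n : n`!%:R = poch (1 : C) n.
Proof.
elim: n => [|n IH]; first by rewrite /poch big_ord0.
by rewrite poch_succ -IH factS natrM nat1r mulrC.
Qed.

Lemma one_not_nonpos n : (1 : C) != - n%:R.
Proof. by rewrite -addr_eq0 nat1r pnatr_eq0. Qed.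

Lemma eventually_decreasing_bounded (v : nat -> R) N :
  (forall n, 0 <= v n) -> (forall n, (N <= n)%N -> v n.+1 <= v n) ->
  exists K, forall n, v n <= K.
Proof.
move=> v0 vN; exists (\sum_(i < N.+1) v i) => n.
have small m : (m <= N)%N -> v m <= \sum_(i < N.+1) v i.
  move=> mN; rewrite (bigD1 (Ordinal (mN : (m < N.+1)%N)))//=.
  by rewrite lerDl sumr_ge0.
elim: n => [|n IH]; first exact: small.
have [nN|Nn] := leqP N n; last exact: small.
exact: le_trans (vN _ nN) IH.
Qed.

(** For r < 1 the quotient of consecutive terms, r (x + n) / (y + n), is
    eventually of modulus at most 1. *)
Lemma tame_poch_ratio (x y : C) : (forall n, y != - n%:R) ->
  tame (fun n => poch x n / poch y n).
Proof.
move=> y0 r /andP[r0 r1].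
(* From N on, r (|x| + n) <= n - |y|. *)
pose N := Num.Def.archi_bound ((r * normc x + normc y) / (1 - r)).
apply: (@eventually_decreasing_bounded _ N) => n.
  by rewrite mulr_ge0 ?normc_ge0 ?exprn_ge0.
move=> Nn; have r1' : 0 < 1 - r by rewrite subr_gt0.
have large : r * normc x + normc y <= n%:R * (1 - r).
  rewrite -ler_pdivrMr//; apply: (@le_trans _ _ N%:R); last by rewrite ler_nat.
  apply/ltW/archi_boundP; rewrite divr_ge0 ?(ltW r1')//.
  by rewrite addr_ge0 ?mulr_ge0 ?normc_ge0.
have yn0 : 0 < normc (y + n%:R).
  rewrite lt_neqAle normc_ge0 andbT eq_sym; apply/eqP => /eq0_normc/eqP.
  by rewrite addr_eq0; exact/negP.
rewrite !poch_succ invfM mulrACA normcM exprSr [leLHS]mulrACA.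
rewrite ler_piMr ?mulr_ge0 ?normc_ge0 ?exprn_ge0//.
rewrite normcM normcV mulrAC ler_pdivrMr// mul1r.
apply: (@le_trans _ _ ((normc x + n%:R) * r)).
  by rewrite ler_wpM2r// -(@normc_nat R n) le_normcD.
have le_y : n%:R <= normc (y + n%:R) + normc y.
  have := le_normcD (y + n%:R) (- y).
  by rewrite normcN addrAC subrr add0r normc_nat.
by move: large le_y; lra.
Qed.
End Pochhammer.

Section Hypergeometric.
Variables (R : realType) (q : nat).
Local Notation C := (R[i]).

Definition hypcoef p (A : 'rV[C]_p) (B : 'rV[C]_q) (n : nat) : C :=
  (\prod_(i < p) poch (A 0 i) n) / ((\prod_(j < q) poch (B 0 j) n) * n`!%:R).

Variables (A : 'rV[C]_q.+1) (B : 'rV[C]_q).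
Hypothesis B0 : forall j n, B 0 j != - n%:R.

(** As there is one more upper parameter than lower ones, the upper Pochhammer
    symbols are paired with the lower ones and with n! = (1)_n. *)
Lemma tame_hypcoef : tame (hypcoef A B).
Proof.
apply: (@eq_tame _ (fun n => poch (A 0 ord0) n / poch 1 n
  * \prod_(j < q) (poch (A 0 (lift ord0 j)) n / poch (B 0 j) n))).
  move=> n; rewrite /hypcoef big_ord_recl prodf_div fact_poch invfM.
  by rewrite mulrACA [_^-1 * _]mulrC.
apply: tameM; first by apply: tame_poch_ratio; exact: one_not_nonpos.
by apply: tame_prod => j; exact: tame_poch_ratio.
Qed.

Lemma hasSum_hyp z : normc z < 1 ->
  hasSum (fun n => hypcoef A B n * z ^+ n) (hyp A B z).
Proof.
move=> z1; have [s As] := hasSum_tame tame_hypcoef z1.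
by rewrite (_ : hyp A B z = s)//; exact: hasSum_lim As.
Qed.

Lemma hypcoef0 : hypcoef A B 0 = 1.
Proof.
rewrite /hypcoef !big1 ?mulr1 ?divr1// => i _; by rewrite /poch big_ord0.
Qed.

Lemma hypcoef_succ n :
  n.+1%:R * \prod_(j < q) (B 0 j + n%:R) * hypcoef A B n.+1
  = \prod_(i < q.+1) (A 0 i + n%:R) * hypcoef A B n.
Proof.
have prod_succ m (X : 'rV[C]_m) : \prod_(i < m) poch (X 0 i) n.+1
    = \prod_(i < m) poch (X 0 i) n * \prod_(i < m) (X 0 i + n%:R).
  by rewrite -big_split; apply: eq_bigr => i _; exact: poch_succ.
have B_neq0 : \prod_(j < q) (B 0 j + n%:R) != 0.
  by apply/prodf_neq0 => j _; rewrite addr_eq0.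
rewrite /hypcoef !prod_succ factS natrM.
set PA := \prod_(i < q.+1) poch _ n; set PB := \prod_(j < q) poch _ n.
have PB0 : PB != 0 by apply/prodf_neq0 => j _; exact: poch_neq0.
have n0 : (n`!%:R : C) != 0 by rewrite pnatr_eq0 -lt0n fact_gt0.
have n1 : (n.+1%:R : C) != 0 by rewrite pnatr_eq0.
move: PA PB PB0 (n`!%:R) n0 (n.+1%:R) n1 B_neq0 => PA PB PB0 F F0 m m0.
move: (\prod_(j < q) (B 0 j + n%:R)) (\prod_(i < _) _) => P Q P0.
by field; rewrite F0 m0 PB0 P0.
Qed.
End Hypergeometric.

(** * Clausen's formula and its derivatives *)

Section Clausen.
Variables (R : realType) (a b : R[i]).
Local Notation C := (R[i]).
Hypothesis gauss_lo0 : forall (j : 'I_1) n, gauss_lo a b 0 j != - n%:R.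
Hypothesis clausen_lo0 : forall (j : 'I_2) n, clausen_lo a b 0 j != - n%:R.

Let c := a + b + 2^-1.
Let t := hypcoef (gauss_up a b) (gauss_lo a b).
Let T := hypcoef (clausen_up a b) (clausen_lo a b).

Lemma gauss_recurrence n :
  n.+1%:R * (c + n%:R) * t n.+1 = (a + n%:R) * (b + n%:R) * t n.
Proof.
have := hypcoef_succ (gauss_up a b) gauss_lo0 n.
by rewrite !big_ord_recl !big_ord0 !mxE /= !mulr1.
Qed.

Lemma clausen_recurrence n :
  n.+1%:R * (2 * a + 2 * b + n%:R) * (c + n%:R) * T n.+1
  = (2 * a + n%:R) * (2 * b + n%:R) * (a + b + n%:R) * T n.
Proof.
have := hypcoef_succ (clausen_up a b) clausen_lo0 n.
by rewrite !big_ord_recl !big_ord0 !mxE /= !mulr1 !mulrA.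
Qed.

(** The leading factor of the common recurrence does not vanish, because the
    lower parameters of h are not nonpositive integers. *)
Lemma clausen_coef n : cauchy_prod t t n = T n.
Proof.
elim: n => [|n IH].
  rewrite /cauchy_prod big_ord_recl big_ord0 subn0.
  by rewrite /t /T !hypcoef0 mulr1 addr0.
have cE : 2 * c = 2 * (a + b) + 1 by rewrite /c mulrDr divff// pnatr_eq0.
have := cauchy_prod_sqr_recurrence cE gauss_recurrence n.
rewrite IH -clausen_recurrence; apply: mulfI.
rewrite !mulf_neq0 ?pnatr_eq0 ?addr_eq0//.
  by have := clausen_lo0 ord0 n; rewrite mxE.
by have := clausen_lo0 (lift ord0 ord0) n; rewrite mxE.
Qed.

Lemma disc_series_f : disc_series t (f a b).
Proof.
split=> [|z z1]; first exact: tame_hypcoef.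
exact: (@hasSum_hyp _ _ (gauss_up a b) _ gauss_lo0 z z1).
Qed.

Lemma disc_series_h : disc_series T (h a b).
Proof.
split=> [|z z1]; first exact: tame_hypcoef.
exact: (@hasSum_hyp _ _ (clausen_up a b) _ clausen_lo0 z z1).
Qed.

Lemma clausen_formula z : normc z < 1 -> h a b z = f a b z ^+ 2.
Proof.
move=> z1; rewrite expr2.
apply: (disc_series_eq disc_series_h (k := fun z => f a b z * f a b z)) => //.
have := disc_seriesM disc_series_f disc_series_f.
by apply: disc_series_ext; exact: clausen_coef.
Qed.

Local Notation f1 := (theta (f a b)).
Local Notation f2 := (theta f1).

Lemma theta_h z : normc z < 1 -> theta (h a b) z = 2 * (f a b z * f1 z).
Proof.
move=> z1; rewrite (theta_eq disc_series_h clausen_formula z1).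
under [X in theta X]funext do rewrite expr2.
rewrite (thetaM disc_series_f disc_series_f z1); ring.
Qed.

Lemma theta2_h z : normc z < 1 ->
  theta (theta (h a b)) z = 2 * (f1 z ^+ 2 + f a b z * f2 z).
Proof.
move=> z1; have Sf := disc_series_f; have Sf1 := disc_series_theta Sf.
pose k w := f a b w * f1 w + f a b w * f1 w.
have hk w : normc w < 1 -> theta (h a b) w = k w.
  by move=> w1; rewrite theta_h// /k mulrDl mul1r.
have Sff1 := disc_seriesM Sf Sf1.
apply: etrans (theta_eq (disc_series_theta disc_series_h) hk z1) _.
apply: etrans (thetaD Sff1 Sff1 z1) _.
have := thetaM Sf Sf1 z1.
by move: (theta (fun _ => _) z) => x ->; rewrite expr2 mulrDl mul1r.
Qed.

(** Comparison of theta (theta + c - 1) f with z (theta + a) (theta + b) f,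
    coefficient by coefficient. *)
Lemma gauss_ode z : normc z < 1 ->
  (1 - z) * f2 z = ((a + b) * z - c + 1) * f1 z + a * b * z * f a b z.
Proof.
move=> z1; have [[_ S0] [_ S1] [_ S2]] := And3 disc_series_f
  (disc_series_theta disc_series_f)
  (disc_series_theta (disc_series_theta disc_series_f)).
have lower := hasSumD (S2 z z1) (hasSumZ (c - 1) (S1 z z1)).
have upper := hasSumZ z (hasSumD
  (hasSumD (S2 z z1) (hasSumZ (a + b) (S1 z z1))) (hasSumZ (a * b) (S0 z z1))).
have : f2 z + (c - 1) * f1 z
  = z * (f2 z + (a + b) * f1 z + a * b * f a b z).
  apply: hasSum_uniq lower _; apply: hasSum_shift upper => [|n] /=.
    by rewrite !mul0r mulr0 add0r.
  have := gauss_recurrence n; rewrite exprS -natr1 => e.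
  transitivity (z * z ^+ n * ((n%:R + 1) * (c + n%:R) * t n.+1)); first by ring.
  by rewrite e; ring.
move: (f2 z) (f1 z) (f a b z) c => x y w c' /eqP.
rewrite -subr_eq0 => /eqP e.
by apply/eqP; rewrite -subr_eq0 -[X in _ == X]e; apply/eqP; ring.
Qed.

End Clausen.

(** * Values of rational functions *)

Section Fractions.
Local Open Scope quotient_scope.

Lemma fracE (D : idomainType) (r : {fraction D}) :
  r = tofrac \n_(repr r) / tofrac \d_(repr r).
Proof.
have d0 : tofrac \d_(repr r) != 0 :> {fraction D}.
  by rewrite tofrac_eq0; exact: denom_ratioP.
have clear_denom (x : {ratio D}) :
    \pi_(FracField.type D) x * tofrac \d_x = tofrac \n_x :> {fraction D}.
  unlock tofrac; rewrite -[LHS]FracField.pi_mul; apply/eqmodP.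
  rewrite /= FracField.equivfE /FracField.mulf.
  by rewrite !numden_Ratio ?mulr1 ?oner_neq0 ?mulf_neq0 ?denom_ratioP// mulrC.
by apply: (mulIf d0); rewrite divfK// -clear_denom reprK.
Qed.

Lemma eq_frac (D : idomainType) (p q p' q' : D) : q != 0 -> q' != 0 ->
  (tofrac p / tofrac q == tofrac p' / tofrac q' :> {fraction D}) =
  (p * q' == p' * q).
Proof. by move=> q0 q'0; rewrite eqr_div ?tofrac_eq0// -!tofracM tofrac_eq. Qed.

End Fractions.

(** An invertible substitution is injective, so it maps denominators to
    nonzero polynomials. *)
Lemma comp_mpolyK (K : comNzRingType) (n : nat) (s s' : n.-tuple (mpoly n K)) :
  (forall i, comp_mpoly s' (tnth s i) = mpolyX K (mnm1 i)) ->
  cancel (comp_mpoly s) (comp_mpoly s').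
Proof.
move=> ss' p; rewrite [X in comp_mpoly _ X]comp_mpolyEX raddf_sum/= [RHS]mpolyE.
apply: eq_bigr => m _; rewrite /= comp_mpolyZ comp_mpolyX rmorph_prod.
rewrite [in RHS]mpolyXE_id; congr (_ *: _).
by apply: eq_bigr => i _; rewrite /= rmorphXn/= ss'.
Qed.

Section Values.
Variable R : realType.
Local Notation C := (R[i]).
Local Notation P3 := (mpoly 3 C).
Implicit Types (p q : P3) (r : ratfun R) (a b z w : C).

Lemma meval_neq0 (x : 'I_3 -> C) q : meval x q != 0 -> q != 0.
Proof. by apply: contra_neq => ->; rewrite meval0. Qed.

Lemma has_value_uniq r a b z w w' :
  has_value r a b z w -> has_value r a b z w' -> w = w'.
Proof.
move=> [p [q [q0 -> ->]]] [p' [q' [q'0 e ->]]].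
have tq0 := meval_neq0 q0; have tq'0 := meval_neq0 q'0.
move/eqP: e; rewrite eq_frac// => /eqP e.
by apply/eqP; rewrite eqr_div// -!mevalM e.
Qed.

Lemma has_value_tofrac p a b z :
  has_value (tofrac p) a b z (meval (Defs.point a b z) p).
Proof.
by exists p, 1; rewrite meval1 tofrac1 !divr1; split=> //; exact: oner_neq0.
Qed.

Lemma has_value_nat n a b z : has_value (n%:R : ratfun R) a b z n%:R.
Proof.
have := has_value_tofrac n%:R a b z; rewrite rmorph_nat.
by rewrite (rmorph_nat (meval (Defs.point a b z))).
Qed.

Lemma has_valueD r r' a b z w w' :
  has_value r a b z w -> has_value r' a b z w' ->
  has_value (r + r') a b z (w + w').
Proof.
move=> [p [q [q0 -> ->]]] [p' [q' [q'0 -> ->]]].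
exists (p * q' + p' * q), (q * q'); split; first by rewrite mevalM mulf_neq0.
  rewrite addf_div ?tofrac_eq0 ?(meval_neq0 q0) ?(meval_neq0 q'0)//.
  by rewrite tofracD !tofracM.
by rewrite addf_div// mevalD !mevalM.
Qed.

Lemma has_valueM r r' a b z w w' :
  has_value r a b z w -> has_value r' a b z w' ->
  has_value (r * r') a b z (w * w').
Proof.
move=> [p [q [q0 -> ->]]] [p' [q' [q'0 -> ->]]].
exists (p * p'), (q * q'); split; first by rewrite mevalM mulf_neq0.
  by rewrite mulf_div !tofracM.
by rewrite mulf_div !mevalM.
Qed.

Lemma has_valueN r a b z w : has_value r a b z w -> has_value (- r) a b z (- w).
Proof.
move=> [p [q [q0 -> ->]]]; exists (- p), q; split=> //.
  by rewrite tofracN mulNr.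
by rewrite mevalN mulNr.
Qed.

Lemma has_valueV r a b z w : w != 0 -> has_value r a b z w ->
  has_value r^-1 a b z w^-1.
Proof.
move=> w0 [p [q [q0 -> we]]]; exists q, p; split.
- by apply: contra_neq w0 => p0; rewrite we p0 mul0r.
- by rewrite invf_div.
- by rewrite we invf_div.
Qed.

Lemma has_value_sum (I : Type) (s : seq I) (F : I -> ratfun R) (G : I -> C)
    a b z :
  (forall i, has_value (F i) a b z (G i)) ->
  has_value (\sum_(i <- s) F i) a b z (\sum_(i <- s) G i).
Proof.
move=> FG; elim/big_ind2: _ => //; first exact: (has_value_nat 0).
by move=> ? ? ? ? H H'; apply: has_valueD.
Qed.

Definition mx_value m n (M : 'M[ratfun R]_(m, n)) a b z (N : 'M[C]_(m, n)) :=
  forall i j, has_value (M i j) a b z (N i j).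

Lemma mx_value_mul m n k (M : 'M_(m, n)) (M' : 'M_(n, k)) N N' a b z :
  mx_value M a b z N -> mx_value M' a b z N' ->
  mx_value (M *m M') a b z (N *m N').
Proof.
move=> MN MN' i j; rewrite !mxE; apply: has_value_sum => l.
exact: has_valueM.
Qed.

Lemma mx_valueB m n (M M' : 'M_(m, n)) N N' a b z :
  mx_value M a b z N -> mx_value M' a b z N' ->
  mx_value (M - M') a b z (N - N').
Proof.
by move=> MN MN' i j; rewrite !mxE; apply/has_valueD/has_valueN.
Qed.

Lemma mx_value_Sym2 M N a b z : mx_value M a b z N ->
  mx_value (Sym2 M) a b z (Sym2 N).
Proof.
move=> MN i j; rewrite !mxE.
have v2 := has_value_nat 2 a b z.
by case: i j => [[|[|[|?]]] ?] [[|[|[|?]]] ?] //=; rewrite ?expr2;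
  do ?[exact: v2 | exact: MN | apply: has_valueD | apply: has_valueM].
Qed.

Definition Phi_at a b z : 'M[C]_3 :=
  mxl 3 3 [:: [:: 1; 0; 2 * a * b * z / (1 - z)];
              [:: 0; 2; 2 * ((a + b) * z - (a + b + 2^-1) + 1) / (1 - z)];
              [:: 0; 0; 2]].

Lemma mx_value_Phi a b z : z != 1 -> mx_value (Phi R) a b z (Phi_at a b z).
Proof.
move=> z1.
have va : has_value (ra R) a b z a.
  have := has_value_tofrac (var R (inord 0)) a b z.
  by rewrite mevalXU /Defs.point inordK.
have vb : has_value (rb R) a b z b.
  have := has_value_tofrac (var R (inord 1)) a b z.
  by rewrite mevalXU /Defs.point inordK.
have vz : has_value (rz R) a b z z.
  have := has_value_tofrac (var R (inord 2)) a b z.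
  by rewrite mevalXU /Defs.point inordK.
have v n := has_value_nat n a b z.
have z1' : 1 - z != 0 by rewrite subr_eq0 eq_sym.
have n2 : (2 : C) != 0 by rewrite pnatr_eq0.
move=> i j; rewrite !mxE.
by case: i j => [[|[|[|?]]] ?] [[|[|[|?]]] ?] //=;
  do ?[exact: v | exact: (v 0) | exact: (v 1%N) | apply: has_valueD
      | apply: has_valueM | apply: has_valueN | apply: has_valueV].
Qed.

Lemma common_denominator m n (M : 'M[ratfun R]_(m, n)) :
  exists2 d : P3, d != 0 &
    exists N : 'M[P3]_(m, n), forall i j, M i j = tofrac (N i j) / tofrac d.
Proof.
pose den (ij : 'I_m * 'I_n) : P3 := \d_(repr (M ij.1 ij.2)).
have den0 ij : den ij != 0 by exact: denom_ratioP.
exists (\prod_ij den ij); first exact/prodf_neq0.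
exists (\matrix_(i, j) (\n_(repr (M i j)) * \prod_(kl | kl != (i, j)) den kl)).
move=> i j; rewrite mxE [in X in _ / X](bigD1 (i, j))//= !tofracM.
rewrite [LHS]fracE -mulf_div divff ?mulr1// tofrac_eq0; exact/prodf_neq0.
Qed.

Lemma mx_value_exists m n (M : 'M[ratfun R]_(m, n)) : exists2 d : P3, d != 0 &
  forall a b z, meval (Defs.point a b z) d != 0 -> exists N, mx_value M a b z N.
Proof.
have [d d0 [N MN]] := common_denominator M; exists d => // a b z dz.
exists (\matrix_(i, j) (meval (Defs.point a b z) (N i j)
                        / meval (Defs.point a b z) d)).
by move=> i j; rewrite mxE; exists (N i j), d.
Qed.

(** Relations need only be checked outside a hypersurface d = 0.  With e a
    common denominator of the entries of M and k = d e, the polynomial entries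
    of k^2 M = k (k M) vanish where k does, so the relation with coefficients
    k^2 M holds at every point of the domain. *)
Lemma lin_indep_generic n (B : rowfam R n) (m : nat) (M : 'M[ratfun R]_(n, m))
    (d : P3) : lin_indep B -> d != 0 ->
  (forall a b z, dom a b z -> meval (Defs.point a b z) d != 0 ->
     exists2 N, mx_value M a b z N & B a b z *m N = 0) ->
  M = 0.
Proof.
move=> freeB d0 BM.
have [e e0 [P MP]] := common_denominator M.
pose k := d * e; have k0 : k != 0 by rewrite mulf_neq0.
have te0 : tofrac e != 0 :> ratfun R by rewrite tofrac_eq0.
have scaled i j : tofrac (k ^+ 2) * M i j = tofrac (k * (d * P i j)).
  rewrite MP mulrA; apply: (canLR (mulfK te0)).
  rewrite -(tofracM (k ^+ 2) (P i j)) -(tofracM _ e); congr tofrac.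
  by rewrite expr2 -[LHS]mulrA -[RHS]mulrA; congr (k * _); rewrite /k mulrAC.
suff colM0 j : tofrac (k ^+ 2) *: col j M = 0.
  apply/matrixP => i j; have /matrixP/(_ i 0) := colM0 j; rewrite !mxE => /eqP.
  by rewrite mulf_eq0 tofrac_eq0 expf_eq0 (negPf k0) /= => /eqP.
apply: freeB => a b z N ab_dom vN.
have [kz|kz] := eqVneq (meval (Defs.point a b z) k) 0.
  suff -> : N = 0 by rewrite mulmx0.
  apply/matrixP => i l; rewrite [l]ord1 [RHS]mxE.
  have := vN i 0; rewrite !mxE scaled => /has_value_uniq.
  move=> /(_ _ (has_value_tofrac _ a b z)) ->.
  by rewrite mevalM kz mul0r.
have dz : meval (Defs.point a b z) d != 0.
  by apply: contra_neq kz => dz; rewrite mevalM dz mul0r.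
have [N' vN' BN'] := BM a b z ab_dom dz.
suff -> : N = meval (Defs.point a b z) (k ^+ 2) *: col j N'.
  by rewrite -scalemxAr colE mulmxA BN' mul0mx scaler0.
apply/matrixP => i l; rewrite [l]ord1 !mxE.
apply: (has_value_uniq (vN i 0)); rewrite !mxE.
by apply: has_valueM; [exact: has_value_tofrac|exact: vN'].
Qed.

(** [ratsubst] is defined through a chosen representative of the fraction;
    injectivity of the substitution makes the result independent of it. *)
Lemma has_value_ratsubst (s s' : 3.-tuple P3) r a b z a' b' w :
  (forall i, comp_mpoly s' (tnth s i) = mpolyX C (mnm1 i)) ->
  (forall i, meval (Defs.point a b z) (tnth s i) = Defs.point a' b' z i) ->
  has_value r a' b' z w -> has_value (ratsubst s r) a b z w.
Proof.
move=> ss' s_pt [p [q [q0 rpq ->]]].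
have meval_s p' : meval (Defs.point a b z) (comp_mpoly s p')
    = meval (Defs.point a' b' z) p'.
  by rewrite comp_mpoly_meval; exact: meval_eq.
have comp_sM x y : comp_mpoly s (x * y) = comp_mpoly s x * comp_mpoly s y.
  exact: rmorphM.
have sq0 : comp_mpoly s q != 0.
  by apply: (@meval_neq0 (Defs.point a b z)); rewrite meval_s.
have sd0 : comp_mpoly s \d_(repr r) != 0.
  rewrite -(comp_mpoly0 s) (can_eq (comp_mpolyK ss')).
  exact: denom_ratioP.
exists (comp_mpoly s p), (comp_mpoly s q); split; first by rewrite meval_s.
  apply/eqP; apply: etrans (eq_frac _ _ sd0 sq0) _.
  apply/eqP; apply: etrans (esym (comp_sM _ _)) (etrans _ (comp_sM _ _)).
  congr (comp_mpoly s _); apply/eqP.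
  by rewrite -(eq_frac _ _ (denom_ratioP _) (meval_neq0 q0)) -fracE -rpq.
by congr (_ / _); rewrite meval_s.
Qed.

Lemma tnth_inord (T : Type) (x0 x1 x2 : T) k : (k < 3)%N ->
  tnth [tuple x0; x1; x2] (inord k) = nth x0 [:: x0; x1; x2] k.
Proof. by move=> k3; rewrite (tnth_nth x0) inordK. Qed.

Lemma ord3_ind (Q : 'I_3 -> Prop) :
  Q (inord 0) -> Q (inord 1) -> Q (inord 2) -> forall i, Q i.
Proof.
by move=> Q0 Q1 Q2 i; rewrite -(inord_val i); case: i => [[|[|[|?]]] ?].
Qed.

Lemma has_value_translate (s t : C) r a b z w :
  has_value r (a + s) (b + t) z w ->
  has_value (ratsubst [tuple var R (inord 0) + mpolyC 3 s;
                             var R (inord 1) + mpolyC 3 t; var R (inord 2)] r)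
    a b z w.
Proof.
apply: (@has_value_ratsubst _ [tuple var R (inord 0) - mpolyC 3 s;
                             var R (inord 1) - mpolyC 3 t; var R (inord 2)]).
- by apply: ord3_ind; rewrite tnth_inord//= ?comp_mpolyD ?comp_mpolyC
    comp_mpolyXU -tnth_nth tnth_inord//= subrK.
- by apply: ord3_ind; rewrite tnth_inord//= ?mevalD ?mevalC mevalXU
    /Defs.point !inordK.
Qed.

Lemma has_value_sigma_u r a b z w :
  has_value r (a + 1) b z w -> has_value (sigma_u r) a b z w.
Proof.
rewrite -{1}[b]addr0 => /has_value_translate.
by rewrite mpolyC1 mpolyC0 addr0.
Qed.

Lemma has_value_sigma_v r a b z w :
  has_value r a (b + 1) z w -> has_value (sigma_v r) a b z w.
Proof.
rewrite -{1}[a]addr0 => /has_value_translate.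
by rewrite mpolyC1 mpolyC0 addr0.
Qed.

End Values.

(** * Transporting the generators *)

(** The defining property of the symmetric square: if (x', y') = (x, y) N then
    its products of degree two are those of (x, y) times [Sym2 N]. *)
Lemma square_row_Sym2 (K : comNzRingType) (x y : K) (N : 'M[K]_2) :
  let x' := x * N 0 0 + y * N 1 0 in let y' := x * N 0 1 + y * N 1 1 in
  rowl 3 [:: x ^+ 2; x * y; y ^+ 2] *m Sym2 N
  = rowl 3 [:: x' ^+ 2; x' * y'; y' ^+ 2].
Proof.
apply/rowP => j; rewrite !mxE !big_ord_recl big_ord0 !mxE /=.
by case: j => [[|[|[|?]]] ?] //=; ring.
Qed.

Section Conjugation.
Variable R : realType.
Local Notation C := (R[i]).
Implicit Types a b z s t : C.

Lemma dom_normc a b z : dom a b z -> normc z < 1.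
Proof. by move=> [_ _]; rewrite normC_normc ltcR. Qed.

Lemma Bh_Sf_Phi a b z : dom a b z ->
  Bh a b z = Sf a b z *m Phi_at a b z.
Proof.
move=> ab_dom; have z1 := dom_normc ab_dom; have [gl cl _] := ab_dom.
have z0 : 1 - z != 0.
  rewrite subr_eq0; apply: contraTneq z1 => <-.
  by rewrite normc1 ltxx.
have ode := gauss_ode gl z1.
apply/rowP => j; rewrite !mxE !big_ord_recl big_ord0 !mxE.
case: j => [[|[|[|?]]] ?] //=.
- by rewrite (clausen_formula gl cl z1); ring.
- by rewrite (theta_h gl cl z1); ring.
- rewrite (theta2_h gl cl z1).
  have -> : theta (theta (f a b)) z
      = (1 - z) * theta (theta (f a b)) z / (1 - z) by field.
  by rewrite ode; field.
Qed.

Lemma Sf_Sym2 a b a' b' z (N : 'M[C]_2) :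
  Bf a b z *m N = Bf a' b' z -> Sf a b z *m Sym2 N = Sf a' b' z.
Proof.
move=> /rowP BN; have := (BN 0, BN 1).
rewrite !mxE !big_ord_recl !big_ord0 !mxE /= => -[f_eq f1_eq].
rewrite /Sf -f_eq -f1_eq !addr0 (_ : lift ord0 ord0 = 1); last exact: val_inj.
exact: square_row_Sym2.
Qed.

(** The two shifts of the theorem are the instances (s, t) = (1, 0) and
    (0, 1).  Independence is applied to Phi MU - Sym2(Mu) sigma(Phi), so that
    Phi^-1 need not be evaluated. *)
Lemma conjugation s t (sigma : ratfun R -> ratfun R)
    (Mu : 'M[ratfun R]_2) (MU : 'M[ratfun R]_3) :
  (forall a b z, dom a b z -> dom (a + s) (b + t) z) ->
  (forall r a b z w, has_value r (a + s) (b + t) z w ->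
     has_value (sigma r) a b z w) ->
  lin_indep (@Sf R) ->
  acts (@Bf R) Mu (fun a b => Bf (a + s) (b + t)) ->
  acts (@Bh R) MU (fun a b => Bh (a + s) (b + t)) ->
  MU = invmx (Phi R) *m Sym2 Mu *m map_mx sigma (Phi R).
Proof.
move=> dom_shift value_shift freeSf actMu actMU.
suff Phi_MU : Phi R *m MU - Sym2 Mu *m map_mx sigma (Phi R) = 0.
  have /eqP := Phi_MU; rewrite subr_eq0 => /eqP Phi_MU'.
  by rewrite -mulmxA -Phi_MU' mulKmx ?Phi_unit.
have [d d0 Mu_val] := mx_value_exists Mu.
have [e e0 MU_val] := mx_value_exists MU.
apply: (lin_indep_generic (d := d * e) freeSf); first by rewrite mulf_neq0.
move=> a b z ab_dom; rewrite mevalM mulf_eq0 negb_or => /andP[dz ez].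
have [N uN] := Mu_val _ _ _ dz; have [L UL] := MU_val _ _ _ ez.
have z1 : z != 1.
  by apply: contraTneq (dom_normc ab_dom) => ->; rewrite normc1 ltxx.
have vP := mx_value_Phi a b z1.
have vP' := mx_value_Phi (a + s) (b + t) z1.
exists (Phi_at a b z *m L - Sym2 N *m Phi_at (a + s) (b + t) z).
  apply: mx_valueB; apply: mx_value_mul => //; first exact: mx_value_Sym2.
  by move=> i j; rewrite mxE; apply: value_shift; exact: vP'.
have Sf_P := esym (Bh_Sf_Phi ab_dom).
have Sf_P' := esym (Bh_Sf_Phi (dom_shift _ _ _ ab_dom)).
have Bh_L : Bh a b z *m L = Bh (a + s) (b + t) z := actMU _ _ _ _ ab_dom UL.
have Bf_N : Bf a b z *m N = Bf (a + s) (b + t) z := actMu _ _ _ _ ab_dom uN.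
by rewrite mulmxBr !mulmxA Sf_P (Sf_Sym2 Bf_N) Sf_P' Bh_L subrr.
Qed.

Lemma sigma_u_BfE : @sigma_u_Bf R = fun a b => Bf (a + 1) (b + 0).
Proof.
apply/funext => a; apply/funext => b.
have up : gauss_up a b + rowl 2 [:: 1; 0] = gauss_up (a + 1) (b + 0).
  apply/rowP => j; rewrite !mxE.
  by case: j => [[|[|?]] ?] //=; ring.
have lo : gauss_lo a b + rowl 1 [:: 1] = gauss_lo (a + 1) (b + 0).
  apply/rowP => j; rewrite !mxE.
  by case: j => [[|?] ?] //=; ring.
by rewrite /sigma_u_Bf /shift_Bf up lo.
Qed.

Lemma sigma_v_BfE : @sigma_v_Bf R = fun a b => Bf (a + 0) (b + 1).
Proof.
apply/funext => a; apply/funext => b.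
have up : gauss_up a b + rowl 2 [:: 0; 1] = gauss_up (a + 0) (b + 1).
  apply/rowP => j; rewrite !mxE.
  by case: j => [[|[|?]] ?] //=; ring.
have lo : gauss_lo a b + rowl 1 [:: 1] = gauss_lo (a + 0) (b + 1).
  apply/rowP => j; rewrite !mxE.
  by case: j => [[|?] ?] //=; ring.
by rewrite /sigma_v_Bf /shift_Bf up lo.
Qed.

Lemma sigma_U_BhE : @sigma_U_Bh R = fun a b => Bh (a + 1) (b + 0).
Proof.
apply/funext => a; apply/funext => b.
have up : clausen_up a b + rowl 3 [:: 2; 0; 1] = clausen_up (a + 1) (b + 0).
  apply/rowP => j; rewrite !mxE.
  by case: j => [[|[|[|?]]] ?] //=; ring.
have lo : clausen_lo a b + rowl 2 [:: 2; 1] = clausen_lo (a + 1) (b + 0).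
  apply/rowP => j; rewrite !mxE.
  by case: j => [[|[|?]] ?] //=; ring.
by rewrite /sigma_U_Bh /shift_Bh up lo.
Qed.

Lemma sigma_V_BhE : @sigma_V_Bh R = fun a b => Bh (a + 0) (b + 1).
Proof.
apply/funext => a; apply/funext => b.
have up : clausen_up a b + rowl 3 [:: 0; 2; 1] = clausen_up (a + 0) (b + 1).
  apply/rowP => j; rewrite !mxE.
  by case: j => [[|[|[|?]]] ?] //=; ring.
have lo : clausen_lo a b + rowl 2 [:: 2; 1] = clausen_lo (a + 0) (b + 1).
  apply/rowP => j; rewrite !mxE.
  by case: j => [[|[|?]] ?] //=; ring.
by rewrite /sigma_V_Bh /shift_Bh up lo.
Qed.

Lemma dom_translate a b z s t : s + t = 1 -> dom a b z -> dom (a + s) (b + t) z.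
Proof.
move=> st [gl cl z1]; split=> // j n; apply/eqP.
- case: j => [[|?] i] //; rewrite !mxE /= => e.
  have := gl (Ordinal i) n.+1; rewrite mxE /= => /eqP; apply.
  by rewrite -[n.+1]addn1 natrD opprD -e -st; ring.
- case: j => [[|[|?]] i] //; rewrite !mxE /= => e.
    have := cl (Ordinal i) n.+2; rewrite mxE /= => /eqP; apply.
    have tE : t = 1 - s by rewrite -st; ring.
    by rewrite -[n.+2]addn2 natrD opprD -e tE; ring.
  have := cl (Ordinal i) n.+1; rewrite mxE /= => /eqP; apply.
  by rewrite -[n.+1]addn1 natrD opprD -e -st; ring.
Qed.
End Conjugation.

Theorem corollary4p7 (R : realType) :
  (forall a b z : R[i], dom a b z -> h a b z = f a b z ^+ 2) /\
  (forall (Mu Mv : 'M[ratfun R]_2) (MU MV : 'M[ratfun R]_3),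
    basis_of_h_module (@Sf R) -> basis_of_h_module (@Bh R) ->
    acts (@Bf R) Mu (@sigma_u_Bf R) ->
    acts (@Bf R) Mv (@sigma_v_Bf R) ->
    acts (@Bh R) MU (@sigma_U_Bh R) ->
    acts (@Bh R) MV (@sigma_V_Bh R) ->
    MU = invmx (Phi R) *m Sym2 Mu *m map_mx (@sigma_u R) (Phi R) /\
    MV = invmx (Phi R) *m Sym2 Mv *m map_mx (@sigma_v R) (Phi R)).
Proof.
split=> [a b z ab_dom|Mu Mv MU MV [freeSf _ _] _].
  have [gl cl _] := ab_dom; exact: (clausen_formula gl cl (dom_normc ab_dom)).
rewrite sigma_u_BfE sigma_v_BfE sigma_U_BhE sigma_V_BhE => hu hv hU hV.
split.
- apply: (conjugation _ _ freeSf hu hU) => [a b z|r a b z w].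
    by apply: dom_translate; rewrite addr0.
  by rewrite addr0; exact: has_value_sigma_u.
- apply: (conjugation _ _ freeSf hv hV) => [a b z|r a b z w].
    by apply: dom_translate; rewrite add0r.
  by rewrite addr0; exact: has_value_sigma_v.
Qed.
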